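(* Suppose that $v\in H(\Omega)$ satisfies the regularity condition $v=\mathcal{L}u$ with $u\in L^2(\Omega)$, where $\mathcal{L}:L^2(\Omega)\to H(\Omega)$ is the bounded, linear, compact operator $$(\mathcal{L}u)(x):=\int_\Omega\mathfrak{K}(x,y)u(y)\,\mathrm{d}y .$$ Then there is a constant $C>0$ (not depending on $v$ or on the centers $\Xi_N$) such that $$\|(I-\Pi_N)v\|_{H(\Omega)}\le C\,\sup_{\xi\in\Omega}|\mathcal{P}_N(\xi)|\;\|\mathcal{L}^{-1}v\|_{L^2(\Omega)},$$ where $\mathcal{L}^{-1}v:=u$.
   Context: $\Omega\subset\mathbb{R}^n$ is a compact set. $\mathfrak{K}:\Omega\times\Omega\to\mathbb{R}$ is a Mercer kernel (continuous, symmetric, of positive type: all matrices $[\mathfrak{K}(\xi_i,\xi_j)]$ are positive semidefinite), bounded on the diagonal. With $\mathfrak{K}_x:=\mathfrak{K}(x,\cdot)$, the native space $H(\Omega)$ is the closure of $\mathrm{span}\{\mathfrak{K}_x:x\in\Omega\}$ with respect to the inner product determined by $(\mathfrak{K}_x,\mathfrak{K}_y)=\mathfrak{K}(x,y)$. $\Xi_N=\{\xi_1,\dots,\xi_N\}\subset\Omega$ is a set of $N$ centers, $H_N:=\mathrm{span}\{\mathfrak{K}_{\xi_i}:1\le i\le N\}$, and $\Pi_N:H(\Omega)\to H_N$ is the $H(\Omega)$-orthogonal projection. The power function of $H_N$ is $\mathcal{P}_N(x):=\sqrt{\mathfrak{K}(x,x)-\mathfrak{K}_N(x,x)}$, where $\mathfrak{K}_N$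 is the reproducing kernel of $H_N$, i.e. $\mathfrak{K}_N(x,y)=\mathfrak{K}_{\Xi_N}(x)^{\mathrm T}\mathbb{K}_N^{-1}\mathfrak{K}_{\Xi_N}(y)$ with $\mathfrak{K}_{\Xi_N}(x)=[\mathfrak{K}_{\xi_1}(x),\dots,\mathfrak{K}_{\xi_N}(x)]^{\mathrm T}$ and $\mathbb{K}_N=[\mathfrak{K}(\xi_i,\xi_j)]$ (when $\mathbb{K}_N$ is invertible). *)

(* Defs.v *)
From HB Require Import structures.
From mathcomp Require Import all_boot all_order all_algebra.
From mathcomp Require Import all_classical all_reals all_analysis.
Set Implicit Arguments.
Unset Strict Implicit.
Unset Printing Implicit Defensive.
Import Order.TTheory GRing.Theory Num.Theory.
Import numFieldNormedType.Exports.
Local Open Scope classical_set_scope.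
Local Open Scope ring_scope.

Section rV_measurable.
Context {R : realType} {n : nat}.

Let coord (i : 'I_n) (x : 'rV[R]_n) : measurableTypeR R := x 0 i.

Let rV_set0 : g_sigma_preimage coord set0.
Proof. exact: sigma_algebra0. Qed.

Let rV_setC A : g_sigma_preimage coord A -> g_sigma_preimage coord (~` A).
Proof. exact: sigma_algebraC. Qed.

Let rV_bigcup (F : (set 'rV[R]_n)^nat) :
  (forall i, g_sigma_preimage coord (F i)) ->
  g_sigma_preimage coord (\bigcup_i (F i)).
Proof. exact: sigma_algebra_bigcup. Qed.

(* The sigma-algebra generated by the coordinates; as the topology of 'rV[R]_n
   is the product topology, this is the Borel sigma-algebra of R^n. *)
HB.instance Definition _ := @isMeasurable.Build default_measure_display
  'rV[R]_n (g_sigma_preimage coord) rV_set0 rV_setC rV_bigcup.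

End rV_measurable.

Section sigma_finite_copy.
Context d (T : measurableType d) (R : realType).
Context (m : {measure set T -> \bar R}).

Definition sigma_finite_copy of sigma_finite setT m : set T -> \bar R := m.

Context (fm : sigma_finite setT m).

HB.instance Definition _ := isMeasure.Build _ _ _ (sigma_finite_copy fm)
  (measure0 m) (measure_ge0 m) (@measure_semi_sigma_additive _ _ _ m).

HB.instance Definition _ :=
  Measure_isSigmaFinite.Build _ _ _ (sigma_finite_copy fm) fm.

End sigma_finite_copy.

Section rV_measurable_fun.
Context {R : realType}.

Lemma measurable_rV_coord n (i : 'I_n) :
  measurable_fun [set: 'rV[R]_n] (fun x => x 0 i : measurableTypeR R).
Proof.
move=> _ Y mY; rewrite setTI; apply: sub_sigma_algebra => /=.
rewrite -bigcup_seq/=; exists i => /=; first by rewrite mem_index_enum.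
by exists Y => //; rewrite setTI.
Qed.

Lemma measurable_fun_rV d (T : measurableType d) n (f : T -> 'rV[R]_n) :
  (forall i, measurable_fun [set: T] (fun x => f x 0 i : measurableTypeR R)) ->
  measurable_fun [set: T] f.
Proof.
move=> mf _ Y mY; rewrite setTI.
apply: (mY [set A | measurable (f @^-1` A)]); split.
- split => /=.
  + by rewrite preimage_set0.
  + by move=> A mA; rewrite setTD preimage_setC; exact: measurableC.
  + by move=> F mF; rewrite preimage_bigcup; exact: bigcup_measurable.
- rewrite -bigcup_seq/= => A [i _ [B mB <-]] /=.
  by have := mf i measurableT B mB; rewrite !setTI.
Qed.

Definition rV_cons n (p : measurableTypeR R * 'rV[R]_n) : 'rV[R]_n.+1 :=
  \row_i oapp (p.2 0) p.1 (unlift ord0 i).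

Lemma measurable_rV_cons n : measurable_fun setT (@rV_cons n).
Proof.
apply: measurable_fun_rV => i.
rewrite (_ : (fun x => _) = fun p : measurableTypeR R * 'rV[R]_n =>
  oapp (p.2 0) p.1 (unlift ord0 i)); last by apply/funext => p; rewrite mxE.
case: unliftP => [j|] _ /=; last exact: measurable_fst.
exact: (measurableT_comp (measurable_rV_coord j) measurable_snd).
Qed.

Fixpoint lebesgue_rV n : set 'rV[R]_n -> \bar R :=
  match n with
  | 0 => \d_(0 : 'rV[R]_0)
  | m.+1 => pushforward (lebesgue_measure \x @lebesgue_rV m)%E (@rV_cons m)
  end.

Let rV_uncons n (x : 'rV[R]_n.+1) : measurableTypeR R * 'rV[R]_n :=
  (x 0 ord0, \row_i x 0 (lift ord0 i)).

Let rV_consK n : cancel (@rV_cons n) (@rV_uncons n).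
Proof.
case=> a x; rewrite /rV_uncons /rV_cons mxE unlift_none /=; congr pair.
by apply/rowP => i; rewrite !mxE liftK.
Qed.

Let measurable_rV_uncons n : measurable_fun setT (@rV_uncons n).
Proof.
apply: measurable_fun_pair; first exact: measurable_rV_coord.
apply: measurable_fun_rV => i.
rewrite (_ : (fun x => _) = fun x : 'rV[R]_n.+1 => x 0 (lift ord0 i)).
  exact: measurable_rV_coord.
by apply/funext => x; rewrite mxE.
Qed.

Lemma lebesgue_rV_sigma_finite n :
  exists m : {sigma_finite_measure set 'rV[R]_n -> \bar R},
    @lebesgue_rV n = m.
Proof.
elim: n => [|n [m mE]] /=.
  by exists \d_(0 : 'rV[R]_0).
pose q : {measure set (measurableTypeR R * 'rV[R]_n)%type -> \bar R} :=
  (@lebesgue_measure R \x m)%E.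
pose mp : {measure set 'rV[R]_n.+1 -> \bar R} :=
  measure_function_pushforward__canonical__measure_function_Measure q
    (@measurable_rV_cons n).
have fp : sigma_finite setT mp.
  have /sigma_finiteP[F [TF ndF Foo]] := sigma_finiteT (@lebesgue_measure R).
  have /sigma_finiteP[G [TG ndG Goo]] := sigma_finiteT m.
  exists (fun k => @rV_uncons n @^-1` (F k `*` G k)).
    rewrite -preimage_bigcup (_ : \bigcup_i _ = setT) ?preimage_setT//.
    rewrite -subTset -setXTT TF TG => -[x y] [/= [k _ Fkx] [l _ Gly]].
    exists (maxn k l) => //; split.
    - by move: x Fkx; exact/subsetPset/ndF/leq_maxl.
    - by move: y Gly; exact/subsetPset/ndG/leq_maxr.
  move=> k; have [mF Fk] := Foo k; have [mG Gk] := Goo k; split.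
    rewrite -[X in measurable X]setTI.
    by apply: measurable_rV_uncons => //; exact: measurableX.
  rewrite /mp /= /pushforward -comp_preimage.
  rewrite (_ : _ \o _ = id); last by apply/funext => x /=; rewrite rV_consK.
  by rewrite /q /= product_measure1E// lte_mul_pinfty// ge0_fin_numE.
by exists (sigma_finite_copy fp); rewrite mE.
Qed.

Section measure.
Variable n : nat.
Local Open Scope ereal_scope.

Let lebesgue_rV0 : @lebesgue_rV n set0 = 0.
Proof. by have [m ->] := lebesgue_rV_sigma_finite n; exact: measure0. Qed.

Let lebesgue_rV_ge0 A : 0 <= @lebesgue_rV n A.
Proof. by have [m ->] := lebesgue_rV_sigma_finite n; exact: measure_ge0. Qed.

Let lebesgue_rV_sigma_additive : semi_sigma_additive (@lebesgue_rV n).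
Proof.
by have [m ->] := lebesgue_rV_sigma_finite n; exact: measure_semi_sigma_additive.
Qed.

HB.instance Definition _ := isMeasure.Build _ _ _ (@lebesgue_rV n)
  lebesgue_rV0 lebesgue_rV_ge0 lebesgue_rV_sigma_additive.

Let sigma_finite_lebesgue_rV : sigma_finite setT (@lebesgue_rV n).
Proof. by have [m ->] := lebesgue_rV_sigma_finite n; exact: sigma_finiteT. Qed.

HB.instance Definition _ := Measure_isSigmaFinite.Build _ _ _ (@lebesgue_rV n)
  sigma_finite_lebesgue_rV.

End measure.

Lemma lebesgue_rV_box n (a b : 'rV[R]_n) : (forall i, a 0 i <= b 0 i) ->
  lebesgue_rV [set x : 'rV[R]_n | forall i, a 0 i <= x 0 i <= b 0 i] =
  (\prod_i (b 0 i - a 0 i))%:E.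
Proof.
elim: n => [|n IH] in a b *; move=> ab.
  rewrite /= big_ord0 /dirac indicE mem_set//.
  by case.
have [m mE] := lebesgue_rV_sigma_finite n.
pose a' : 'rV_n := \row_i a 0 (lift ord0 i).
pose b' : 'rV_n := \row_i b 0 (lift ord0 i).
have mbox : measurable [set x : 'rV[R]_n | forall i, a' 0 i <= x 0 i <= b' 0 i].
  rewrite (_ : [set x | _] = \bigcap_(i in [set: 'I_n])
      ((fun x : 'rV[R]_n => x 0 i : measurableTypeR R) @^-1`
        `[a' 0 i, b' 0 i])).
    apply: fin_bigcap_measurable => // i _.
    by rewrite -[X in measurable X]setTI; exact: measurable_rV_coord.
  apply/seteqP; split => [x xab i _|x xab i] /=.
    by rewrite in_itv/= xab.
  by have := xab i I; rewrite /= in_itv.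
rewrite /= /pushforward (_ : _ @^-1` _ =
  `[a 0 ord0, b 0 ord0] `*` [set x : 'rV[R]_n | forall i, a' 0 i <= x 0 i <= b' 0 i]).
  rewrite mE product_measure1E//= -mE IH; last by move=> i; rewrite !mxE.
  have := ab ord0.
  rewrite lebesgue_measure_itv/= lte_fin big_ord_recl le_eqVlt.
  under eq_bigr do rewrite !mxE.
  case/predU1P => [->|->]; last by rewrite -EFinB -EFinM.
  by rewrite ltxx subrr mul0r mul0e.
apply/seteqP; split => [[x y] /= xy|[x y] /= [xab yab] i].
  split; first by rewrite in_itv/=; have := xy ord0; rewrite mxE unlift_none.
  by move=> i; have := xy (lift ord0 i); rewrite !mxE liftK.
rewrite mxE; case: unliftP => [j ->|->] /=; last by move: xab; rewrite in_itv.
by have := yab j; rewrite !mxE.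
Qed.

End rV_measurable_fun.

Section L2.
Context {R : realType} {n : nat}.
Implicit Types (D : set 'rV[R]_n) (u : 'rV[R]_n -> R).

(* Functions on D are represented by functions on R^n whose values outside D
   are irrelevant; [u \_ D] is the extension by zero of the restriction. *)
Definition L2 D : set ('rV[R]_n -> R) :=
  [set u | u \_ D \in Lfun (@lebesgue_rV R n) 2%:E].

Definition L2_norm D u : R :=
  fine ('N[@lebesgue_rV R n]_2%:E [EFin \o (u \_ D)])%E.

End L2.

Section native_space.
Context {R : realType} {n : nat}.
Local Notation T := 'rV[R]_n.
Context (D : set T) (K : T -> T -> R).
Implicit Types (f g : T -> R) (s t : seq (R * T)).

Record mercer_kernel : Prop := MercerKernel {
  mercer_continuous : {within D `*` D, continuous (fun p : T * T => K p.1 p.2)};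
  mercer_sym : forall x y, D x -> D y -> K x y = K y x;
  mercer_psd : forall m (x : 'I_m -> T), (forall i, D (x i)) ->
    forall c : 'rV[R]_m,
      0 <= (c *m (\matrix_(i, j) K (x i) (x j)) *m c^T) 0 0;
  mercer_bounded : exists M : R, forall x, D x -> K x x <= M }.

(* A sequence [:: (a_1, x_1); ...; (a_m, x_m)] stands for the element
   a_1 K_{x_1} + ... + a_m K_{x_m} of the span of the kernel sections. *)
Definition kcomb s : T -> R := fun y => \sum_(p <- s) p.1 * K p.2 y.

Definition kdot s t : R :=
  \sum_(p <- s) \sum_(q <- t) p.1 * q.1 * K p.2 q.2.

Definition ksub s t : seq (R * T) := s ++ [seq (- p.1, p.2) | p <- t].

(* s is a Cauchy sequence in the span of {K_x : x in D}, for the inner product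
   with (K_x, K_y) = K x y, and f is its limit. *)
Definition native_approx (s : nat -> seq (R * T)) f : Prop :=
  [/\ forall k p, p \in s k -> D p.2,
      forall e : R, 0 < e -> exists k0 : nat, forall i j : nat,
        (k0 <= i)%N -> (k0 <= j)%N ->
        kdot (ksub (s i) (s j)) (ksub (s i) (s j)) < e
    & forall x, D x -> kcomb (s k) x @[k --> \oo] --> f x].

(* The completion of the span, realized as a space of functions on D: as
   |f x| <= sqrt (K x x) |f| on the span, Cauchy sequences converge pointwise
   on D, and the pointwise limit determines the element of the completion. *)
Definition native_space : set (T -> R) :=
  [set f | exists s : nat -> seq (R * T), native_approx s f].

Definition native_dot f g : R :=
  get [set l | exists s t : nat -> seq (R * T),
    [/\ native_approx s f, native_approx t g
      & kdot (s k) (t k) @[k --> \oo] --> l]].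

Definition native_norm f : R := Num.sqrt (native_dot f f).

(* The span of K_{xi_1}, ..., K_{xi_N}, up to equality on D. *)
Definition center_space N (xi : 'I_N -> T) : set (T -> R) :=
  [set f | exists c : 'I_N -> R,
             forall y, D y -> f y = \sum_i c i * K (xi i) y].

(* The orthogonal projection and the reproducing kernel of a subspace are
   unique only up to equality on D; [get] selects a representative. *)
Definition orth_proj (V : set (T -> R)) f : T -> R :=
  get [set p | V p /\ forall h, V h -> native_dot (f \- p) h = 0].

Definition repr_kernel (V : set (T -> R)) : T -> T -> R := fun x =>
  get [set k | V k /\ forall f, V f -> native_dot f k = f x].

Definition power_fun (V : set (T -> R)) : T -> R := fun x =>
  Num.sqrt (K x x - repr_kernel V x x).

Definition kernel_op (u : T -> R) : T -> R := fun x =>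
  \int[@lebesgue_rV R n]_(y in D) (K x y * u y).

End native_space.

(* Main.v *)
Require Import Defs.
From HB Require Import structures.
From mathcomp Require Import all_boot all_order all_algebra.
From mathcomp Require Import all_classical all_reals all_analysis.
From mathcomp Require Import measurable_realfun ring lra.
Set Implicit Arguments.
Unset Strict Implicit.
Unset Printing Implicit Defensive.
Import Order.TTheory GRing.Theory Num.Theory.
Import numFieldNormedType.Exports.
Local Open Scope classical_set_scope.
Local Open Scope ring_scope.

(** Write e = v - Pi v for the residual, |.| for the native norm, and k_x for the
    reproducing kernel of the span of the centers at x.  Since e is orthogonal to
    that span,
<<
      |e|^2 = <e, v>        and        e x = <e, K_x - k_x>.
>>
    The power function at x is exactly |K_x - k_x|, so the Cauchy-Schwarz
    inequality bounds e uniformly on Omega by |e| S, where S is the supremum of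
    the power function ([residual_le], [power_funE]).

    On the other side, pairing with v = L u is integration against u: on a
    section, <K_x, L u> = (L u) x is the integral of K_x u, and this extends
    linearly to the span ([kcomb_integral]).  A bound B of f on Omega therefore
    gives |<f, v>| <= B times the L1 norm of u ([native_dot_kernel_op_le]): elements
    of the span that are close to f in norm are uniformly close to f, because the
    diagonal of K is bounded, so the bound for the span passes to the limit.  It
    is applied to f = e and B = |e| S, which gives |e|^2 <= |e| S |u|_1.  As
    Omega is compact it has finite measure, and the Hoelder inequality compares
    the L1 norm with the L2 norm; the constant is 1 plus the L2 norm of the
    indicator of Omega ([Lfun2_integrable_set]), the 1 making it positive even
    when Omega is a null set.

    Two foundations are needed for this.  The inner product on the native space
    is a limit along Cauchy sequences of finite combinations of sections, and its
    value must not depend on the sequences ([native_dot_cvg]): this rests on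
    [approx_null], by which a Cauchy sequence with pointwise limit 0 tends to 0 in
    norm.  And the integrals require compact sets and functions continuous on
    them to be measurable for the product sigma-algebra ([open_measurable_rV]). *)

(** * Finite combinations of kernel sections *)

Section kernel_combinations.
Context {R : realType} {n : nat} (K : 'rV[R]_n -> 'rV[R]_n -> R).
Implicit Types (s t r : seq (R * 'rV[R]_n)) (a : R).

Definition kscale a s := [seq (a * p.1, p.2) | p <- s].

Lemma ksubE s t : ksub s t = s ++ kscale (-1) t.
Proof. by congr cat; apply: eq_map => p; rewrite mulN1r. Qed.

Lemma kcomb_cat s t y : kcomb K (s ++ t) y = kcomb K s y + kcomb K t y.
Proof. exact: big_cat. Qed.

Lemma kcomb_scale a s y : kcomb K (kscale a s) y = a * kcomb K s y.
Proof.
by rewrite /kcomb big_map mulr_sumr; apply: eq_bigr => p _ /=; rewrite mulrA.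
Qed.

Lemma kcomb_sub s t y : kcomb K (ksub s t) y = kcomb K s y - kcomb K t y.
Proof. by rewrite ksubE kcomb_cat kcomb_scale mulN1r. Qed.

Lemma kdotE s t : kdot K s t = \sum_(q <- t) q.1 * kcomb K s q.2.
Proof.
rewrite /kdot exchange_big; apply: eq_bigr => q _ /=.
by rewrite mulr_sumr; apply: eq_bigr => p _; rewrite mulrA [q.1 * _]mulrC.
Qed.

Lemma kdot_catl s t r : kdot K (s ++ t) r = kdot K s r + kdot K t r.
Proof. exact: big_cat. Qed.

Lemma kdot_catr s t r : kdot K r (s ++ t) = kdot K r s + kdot K r t.
Proof. by rewrite !kdotE big_cat. Qed.

Lemma kdot_scalel a s t : kdot K (kscale a s) t = a * kdot K s t.
Proof.
rewrite !kdotE mulr_sumr; apply: eq_bigr => q _.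
by rewrite kcomb_scale mulrCA.
Qed.

Lemma kdot_scaler a s t : kdot K s (kscale a t) = a * kdot K s t.
Proof.
rewrite !kdotE big_map mulr_sumr; apply: eq_bigr => q _ /=.
by rewrite mulrA.
Qed.

(** Rewriting with this multirule turns an identity or inequality between values
    of the form on combinations into one between polynomials in its values on
    the parts. *)
Definition kdot_lin :=
  (ksubE, kdot_catl, kdot_catr, kdot_scalel, kdot_scaler).

End kernel_combinations.

(** * The semi-inner product on the span *)

Section semi_inner_product.
Context {R : realType} {n : nat} (D : set 'rV[R]_n).
Context (K : 'rV[R]_n -> 'rV[R]_n -> R) (KD : mercer_kernel D K).
Implicit Types (s t : seq (R * 'rV[R]_n)) (a e B : R).

Definition supported s := forall p, p \in s -> D p.2.

Lemma supported_cat s t : supported s -> supported t -> supported (s ++ t).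
Proof. by move=> sD tD p; rewrite mem_cat => /orP[/sD|/tD]. Qed.

Lemma supported_scale a s : supported s -> supported (kscale a s).
Proof. by move=> sD p /mapP[q /sD qD ->]. Qed.

Lemma supported_sub s t : supported s -> supported t -> supported (ksub s t).
Proof.
by move=> sD tD; rewrite ksubE; apply/supported_cat/supported_scale.
Qed.

Lemma kdot_sym s t : supported s -> supported t -> kdot K s t = kdot K t s.
Proof.
move=> sD tD; rewrite /kdot exchange_big /=.
rewrite big_seq [RHS]big_seq; apply: eq_bigr => p /tD pD.
rewrite big_seq [RHS]big_seq; apply: eq_bigr => q /sD qD.
by rewrite (mercer_sym KD)// [q.1 * _]mulrC.
Qed.

Lemma kdot_ge0 s : supported s -> 0 <= kdot K s s.
Proof.
move=> sD; pose x i := tnth (in_tuple s) i.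
have xD i : D (x i).2 by apply/sD/mem_tnth.
have := mercer_psd KD xD (\row_i (x i).1).
rewrite (_ : fun_of_matrix _ _ _ = kdot K s s)//.
rewrite !mxE /kdot exchange_big big_tnth; apply: eq_bigr => j _.
rewrite big_tnth !mxE mulr_suml; apply: eq_bigr => i _.
by rewrite !mxE /x mulrAC.
Qed.

Lemma kdot_parallelogram s t : supported s -> supported t ->
  kdot K (s ++ t) (s ++ t) <= 2 * (kdot K s s + kdot K t t).
Proof.
move=> sD tD; have := kdot_ge0 (supported_sub sD tD).
by rewrite !kdot_lin (kdot_sym tD sD); lra.
Qed.

(** The Gram matrix may be singular, so kdot K t t = 0 does not force t to be
    zero; that case is settled by letting the discriminant argument degenerate to
    an affine function that stays nonnegative only if its slope vanishes. *)
Lemma kdot_CS s t : supported s -> supported t ->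
  kdot K s t ^+ 2 <= kdot K s s * kdot K t t.
Proof.
move=> sD tD.
have H a : 0 <= kdot K s s + 2 * a * kdot K s t + a ^+ 2 * kdot K t t.
  have := kdot_ge0 (supported_cat sD (supported_scale (a := a) tD)).
  by rewrite !kdot_lin (kdot_sym tD sD); lra.
have ss := kdot_ge0 sD.
have := kdot_ge0 tD; rewrite le_eqVlt => /predU1P[t0|t0].
  rewrite -t0 mulr0; have [->|st] := eqVneq (kdot K s t) 0.
    by rewrite expr0n.
  (* at this point the affine function takes the value -1 *)
  have := H (- (kdot K s s + 1) / (2 * kdot K s t)).
  rewrite -t0 mulr0 addr0.
  rewrite (_ : 2 * _ * _ = - (kdot K s s + 1)); last by field.
  by lra.
(* the minimum of the quadratic polynomial *)
have := H (- kdot K s t / kdot K t t).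
rewrite -(pmulr_rge0 _ t0).
rewrite (_ : kdot K t t * _ = kdot K s s * kdot K t t - kdot K s t ^+ 2); first by lra.
by field; rewrite gt_eqF.
Qed.

(** Uniform continuity of the form on bounded sets.  It serves twice: between
    two terms of the same sequences, for the existence of the limit that defines
    the inner product, and between two pairs of sequences, for its uniqueness. *)
Lemma kdot_close B e : 0 < B -> 0 < e -> exists d, 0 < d /\
  forall s s' t t', supported s -> supported s' -> supported t ->
  supported t' -> kdot K t t <= B -> kdot K s' s' <= B ->
  kdot K (ksub s s') (ksub s s') < d -> kdot K (ksub t t') (ksub t t') < d ->
  `|kdot K s t - kdot K s' t'| < e.
Proof.
move=> B0 e0; exists (e ^+ 2 / (4 * B)); split.
  by rewrite divr_gt0 ?exprn_gt0// mulr_gt0.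
move=> s s' t t' sD s'D tD t'D tB sB' ds dt.
have -> : kdot K s t - kdot K s' t' =
    kdot K (ksub s s') t + kdot K s' (ksub t t') by rewrite !kdot_lin; ring.
have half a b x : x ^+ 2 <= a * b -> 0 <= a -> 0 <= b -> a < e ^+ 2 / (4 * B) ->
    b <= B -> `|x| < e / 2.
  move=> xab a0 b0 ad bB.
  rewrite -(@ltr_pXn2r _ 2) ?nnegrE// ?divr_ge0 ?ltW// real_normK ?num_real//.
  apply: (le_lt_trans xab).
  apply: (le_lt_trans (ler_wpM2l a0 bB)).
  rewrite -ltr_pdivlMr//; congr (_ < _): ad.
  by field; rewrite gt_eqF.
rewrite (splitr e); apply: (le_lt_trans (ler_normD _ _)); apply: ltrD.
  apply: (half _ _ _ (kdot_CS (supported_sub sD s'D) tD)) => //.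
    exact/kdot_ge0/supported_sub.
  exact/kdot_ge0.
have := kdot_CS s'D (supported_sub tD t'D); rewrite mulrC => /half.
by apply => //; apply/kdot_ge0 => //; exact: supported_sub.
Qed.

End semi_inner_product.

(** * The inner product of the native space *)

Section native_dot.
Context {R : realType} {n : nat} (D : set 'rV[R]_n).
Context (K : 'rV[R]_n -> 'rV[R]_n -> R) (KD : mercer_kernel D K).
Local Notation H := (native_space D K).
Local Notation dot := (native_dot D K).
Local Notation approx := (native_approx D K).
Implicit Types (s t : nat -> seq (R * 'rV[R]_n)) (f g h : 'rV[R]_n -> R).

Lemma approx_supported s f k : approx s f -> supported D (s k).
Proof. by case=> + _ _; apply. Qed.

Lemma approx_bounded s f : approx s f -> exists B, 0 < B /\
  \forall k \near \oo, kdot K (s k) (s k) <= B.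
Proof.
move=> sf; have [_ /(_ 1 ltr01)[k0 sk] _] := sf.
exists (2 * (kdot K (s k0) (s k0) + 1)); split.
  by rewrite mulr_gt0// ltr_wpDl// (kdot_ge0 KD)//; exact: approx_supported sf.
near=> k.
have s0 := approx_supported (k := k0) sf; have sk' := approx_supported (k := k) sf.
have := kdot_parallelogram KD (supported_sub sk' s0) s0.
have : kdot K (ksub (s k) (s k0)) (ksub (s k) (s k0)) < 1.
  by apply: sk => //; near: k; exact: nbhs_infty_ge.
rewrite !kdot_lin; set X := kdot K (s k) (s k); set Y := kdot K (s k0) (s k0).
by lra.
Unshelve. all: by end_near. Qed.

Lemma approx_sub s t f g : approx s f -> approx t g ->
  approx (fun k => ksub (s k) (t k)) (f \- g).
Proof.
move=> sf tg; have [sD sC sf'] := sf; have [tD tC tg'] := tg; split.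
- by move=> k; apply: supported_sub; [exact: sD|exact: tD].
- move=> e e0; have e40 : 0 < e / 4 by rewrite divr_gt0.
  have [k1 s1] := sC _ e40; have [k2 t2] := tC _ e40.
  exists (maxn k1 k2) => i j; rewrite !geq_max => /andP[i1 i2] /andP[j1 j2].
  have := kdot_parallelogram KD
    (supported_sub (approx_supported (k := i) sf) (approx_supported (k := j) sf))
    (supported_sub (approx_supported (k := j) tg) (approx_supported (k := i) tg)).
  by move: (s1 _ _ i1 j1) (t2 _ _ j2 i2); rewrite !kdot_lin; lra.
- move=> x xD; under eq_cvg do rewrite kcomb_sub.
  by apply: cvgB; [exact: sf'|exact: tg'].
Qed.

Lemma approx_kdot_cvg s f (t : seq (R * 'rV[R]_n)) : approx s f -> supported D t ->
  kdot K (s k) t @[k --> \oo] --> \sum_(q <- t) q.1 * f q.2.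
Proof.
move=> [_ _ sf] tD; rewrite big_seq.
rewrite (_ : (fun k => _) =
  fun k => \sum_(q <- t | q \in t) q.1 * kcomb K (s k) q.2); last first.
  by apply/funext => k; rewrite kdotE big_seq.
have addc : continuous (fun z : R * R => z.1 + z.2) by exact: add_continuous.
apply: (cvg_big addc) => q qt; apply: cvgMl_tmp; apply: sf.
exact: tD qt.
Qed.

(** The pointwise limit determines the element of the completion: for a fixed
    index m, kdot (s k) (s m) is a finite combination of values of s k, hence
    tends to 0, and kdot (s k) (s k) stays close to it when m is large. *)
Lemma approx_null s : approx s (cst 0) ->
  kdot K (s k) (s k) @[k --> \oo] --> 0.
Proof.
move=> s0; have [sD sC sp] := s0; have [B [B0 sB]] := approx_bounded s0.
apply/cvgrPdist_lt => e e0; have e20 : 0 < e / 2 by rewrite divr_gt0.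
have [d [d0 close]] := kdot_close KD B0 e20.
have [k0 sk0] := sC _ d0.
have [m mk0 sm] : exists2 m, (k0 <= m)%N & kdot K (s m) (s m) <= B.
  have [N _ NB] := sB; exists (maxn k0 N); rewrite ?leq_maxl//.
  by apply: NB => /=; rewrite leq_maxr.
have sm0 : kdot K (s k) (s m) @[k --> \oo] --> 0.
  have := approx_kdot_cvg s0 (sD m).
  by rewrite big1// => ? _; rewrite mulr0.
near=> k; rewrite sub0r normrN.
have -> : kdot K (s k) (s k) = (kdot K (s k) (s k) - kdot K (s k) (s m)) +
  kdot K (s k) (s m) by ring.
rewrite (splitr e); apply: (le_lt_trans (ler_normD _ _)); apply: ltrD.
  have kk0 : (k0 <= k)%N by near: k; exact: nbhs_infty_ge.
  apply: close; rewrite ?sk0//; try exact: approx_supported s0.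
    by near: k.
  by near: k.
near: k; move/cvgrPdist_lt: sm0 => /(_ _ e20).
by apply: filterS => k; rewrite sub0r normrN.
Unshelve. all: by end_near. Qed.

Lemma approx_dot_cvg s t f g : approx s f -> approx t g ->
  cvg (kdot K (s k) (t k) @[k --> \oo]).
Proof.
move=> sf tg; have [Bs [Bs0 sB]] := approx_bounded sf.
have [Bt [Bt0 tB]] := approx_bounded tg.
apply/cauchy_cvgP/cauchy_exP => e e0.
have B0 : 0 < Num.max Bs Bt by rewrite lt_max Bs0.
have [d [d0 close]] := kdot_close KD B0 e0.
have [_ /(_ _ d0)[k1 s1] _] := sf; have [_ /(_ _ d0)[k2 t2] _] := tg.
have [m [m1 m2 tm]] :
    exists m, [/\ (k1 <= m)%N, (k2 <= m)%N & kdot K (t m) (t m) <= Bt].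
  have [N _ NB] := tB; exists (maxn (maxn k1 k2) N).
  split; last by apply: NB; rewrite /= leq_maxr.
    by rewrite -maxnA leq_maxl.
  by rewrite maxnAC leq_maxr.
exists (kdot K (s m) (t m)).
suff : \forall k \near \oo, `|kdot K (s m) (t m) - kdot K (s k) (t k)| < e.
  by rewrite -ball_normE.
near=> k; apply: close;
  try by [exact: approx_supported sf | exact: approx_supported tg].
- by rewrite le_max tm orbT.
- by rewrite le_max; apply/orP; left; near: k.
- by apply: s1 => //; near: k; exact: nbhs_infty_ge.
- by apply: t2 => //; near: k; exact: nbhs_infty_ge.
Unshelve. all: by end_near. Qed.

Lemma approx_dot_unique s s' t t' f g :
  approx s f -> approx s' f -> approx t g -> approx t' g ->
  kdot K (s k) (t k) - kdot K (s' k) (t' k) @[k --> \oo] --> 0.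
Proof.
move=> sf sf' tg tg'.
have null x x' h : approx x h -> approx x' h ->
    kdot K (ksub (x k) (x' k)) (ksub (x k) (x' k)) @[k --> \oo] --> 0.
  move=> xh xh'; apply: (@approx_null (fun k => ksub (x k) (x' k))).
  have := approx_sub xh xh'; congr approx.
  by apply/funext => y /=; rewrite subrr.
have [Bs [Bs0 sB]] := approx_bounded sf'.
have [Bt [Bt0 tB]] := approx_bounded tg.
apply/cvgrPdist_lt => e e0.
have B0 : 0 < Num.max Bs Bt by rewrite lt_max Bs0.
have [d [d0 close]] := kdot_close KD B0 e0.
move/cvgrPdist_lt: (null _ _ _ sf sf') => /(_ _ d0) sd.
move/cvgrPdist_lt: (null _ _ _ tg tg') => /(_ _ d0) td.
near=> k; rewrite sub0r normrN; apply: close;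
  try by [exact: approx_supported sf | exact: approx_supported tg|
          exact: approx_supported sf' | exact: approx_supported tg'].
- by rewrite le_max; apply/orP; right; near: k.
- by rewrite le_max; apply/orP; left; near: k.
- apply: le_lt_trans (ler_norm _) _; rewrite -normrN -sub0r; near: k; exact: sd.
- apply: le_lt_trans (ler_norm _) _; rewrite -normrN -sub0r; near: k; exact: td.
Unshelve. all: by end_near. Qed.

Lemma native_dot_cvg s t f g : approx s f -> approx t g ->
  kdot K (s k) (t k) @[k --> \oo] --> dot f g.
Proof.
move=> sf tg.
have [s' [t' [sf' tg' st']]] : exists s' t', [/\ approx s' f, approx t' g
    & kdot K (s' k) (t' k) @[k --> \oo] --> dot f g].
  apply: (@getPex _ [set l | exists s t, [/\ approx s f, approx t g
    & kdot K (s k) (t k) @[k --> \oo] --> l]]).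
  exists (lim (kdot K (s k) (t k) @[k --> \oo])), s, t; split => //.
  exact: approx_dot_cvg sf tg.
rewrite -[X in _ --> X]add0r.
have -> : (fun k => kdot K (s k) (t k)) = fun k =>
    (kdot K (s k) (t k) - kdot K (s' k) (t' k)) + kdot K (s' k) (t' k).
  by apply/funext => k; rewrite subrK.
exact: cvgD (approx_dot_unique sf sf' tg tg') st'.
Qed.

Lemma native_dot_lim s t f g l : approx s f -> approx t g ->
  kdot K (s k) (t k) @[k --> \oo] --> l -> dot f g = l.
Proof.
by move=> sf tg /cvg_lim <- //; apply/esym/cvg_lim => //; exact: native_dot_cvg.
Qed.

Lemma native_sub f g : H f -> H g -> H (f \- g).
Proof.
by move=> [s sf] [t tg]; exists (fun k => ksub (s k) (t k)); exact: approx_sub.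
Qed.

Lemma approx_cst (t : seq (R * 'rV[R]_n)) g : supported D t ->
  (forall x, D x -> g x = kcomb K t x) -> approx (fun=> t) g.
Proof.
move=> tD gE; split=> [//|e e0|x xD]; last by rewrite gE//; exact: cvg_cst.
by exists 0%N => i j _ _; rewrite !kdot_lin; lra.
Qed.

Lemma native_kcomb (t : seq (R * 'rV[R]_n)) g : supported D t ->
  (forall x, D x -> g x = kcomb K t x) -> H g.
Proof. by move=> tD gE; exists (fun=> t); exact: approx_cst. Qed.

Lemma native_dotBl f g h : H f -> H g -> H h ->
  dot (f \- g) h = dot f h - dot g h.
Proof.
move=> [s sf] [t tg] [r rh].
apply: (native_dot_lim (approx_sub sf tg) rh).
rewrite (_ : (fun k => _) = fun k => kdot K (s k) (r k) - kdot K (t k) (r k)).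
  by apply: cvgB; exact: native_dot_cvg.
by apply/funext => k; rewrite !kdot_lin mulN1r.
Qed.

Lemma native_dot_sym f g : H f -> H g -> dot f g = dot g f.
Proof.
move=> [s sf] [t tg]; apply: (native_dot_lim sf tg).
rewrite (_ : (fun k => _) = fun k => kdot K (t k) (s k)).
  exact: native_dot_cvg tg sf.
apply/funext => k; apply: (kdot_sym KD).
  exact: approx_supported sf.
exact: approx_supported tg.
Qed.

Lemma native_dotBr f g h : H f -> H g -> H h ->
  dot h (f \- g) = dot h f - dot h g.
Proof.
move=> Hf Hg Hh; rewrite native_dot_sym ?native_dotBl//; last exact: native_sub.
by congr (_ - _); exact: native_dot_sym.
Qed.

Lemma native_dot_ge0 f : H f -> 0 <= dot f f.
Proof.
move=> [s sf]; have ss := native_dot_cvg sf sf.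
apply: (cvgr_to_ge ss).
by apply: nearW => k; apply: (kdot_ge0 KD); exact: approx_supported sf.
Qed.

Lemma native_dot_CS f g : H f -> H g ->
  dot f g ^+ 2 <= dot f f * dot g g.
Proof.
move=> [s sf] [t tg]; have st := native_dot_cvg sf tg.
have ss := native_dot_cvg sf sf; have tt := native_dot_cvg tg tg.
apply: (ler_cvg_to (cvgM st st) (cvgM ss tt)).
apply: nearW => k; apply: (kdot_CS KD).
  exact: approx_supported sf.
exact: approx_supported tg.
Qed.

Lemma native_dot_normM f g : H f -> H g ->
  `|dot f g| <= native_norm D K f * native_norm D K g.
Proof.
move=> Hf Hg; rewrite -sqrtrM ?native_dot_ge0// -sqrtr_sqr ler_wsqrtr//.
exact: native_dot_CS.
Qed.

Lemma native_dot_kcomb f g (t : seq (R * 'rV[R]_n)) : H f -> supported D t ->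
  (forall x, D x -> g x = kcomb K t x) -> dot f g = \sum_(q <- t) q.1 * f q.2.
Proof.
move=> [s sf] tD gE.
apply: (native_dot_lim sf (approx_cst tD gE)).
exact: approx_kdot_cvg.
Qed.

(** A term of the approximating sequence itself: its distance to f is the
    limit of its distances to the later terms. *)
Lemma native_dense f (e : R) : H f -> 0 < e ->
  exists t : seq (R * 'rV[R]_n), supported D t /\
  native_norm D K (f \- kcomb K t) <= e.
Proof.
move=> [s sf] e0; have [sD sC sp] := sf.
have [k0 sk0] := sC (e ^+ 2) (exprn_gt0 _ e0).
exists (s k0); split; first exact: sD.
rewrite -[e](gtr0_norm e0) -sqrtr_sqr; apply: ler_wsqrtr.
have tt := approx_cst (sD k0) (fun x _ => erefl (kcomb K (s k0) x)).
have st := approx_sub sf tt; have dd := native_dot_cvg st st.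
apply: (cvgr_to_le dd).
near=> k; apply/ltW/sk0 => //; near: k; exact: nbhs_infty_ge.
Unshelve. all: by end_near. Qed.

Lemma native_section x : D x -> H (K x).
Proof.
move=> xD; apply: (@native_kcomb [:: (1, x)]).
  by move=> p; rewrite inE => /eqP ->.
by move=> y yD; rewrite /kcomb big_seq1/= mul1r.
Qed.

Lemma native_reproducing f x : H f -> D x -> dot f (K x) = f x.
Proof.
move=> Hf xD; rewrite (@native_dot_kcomb _ _ [:: (1, x)])//.
- by rewrite big_seq1/= mul1r.
- by move=> p; rewrite inE => /eqP ->.
- by move=> y yD; rewrite /kcomb big_seq1/= mul1r.
Qed.

End native_dot.

(** * Projection on the span of the centers, and the power function *)

Section projection.
Context {R : realType} {n : nat} (D : set 'rV[R]_n).
Context (K : 'rV[R]_n -> 'rV[R]_n -> R) (KD : mercer_kernel D K).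
Context (N : nat) (xi : 'I_N -> 'rV[R]_n) (xiD : forall i, D (xi i)).
Local Notation H := (native_space D K).
Local Notation dot := (native_dot D K).
Local Notation V := (center_space D K xi).
Implicit Types f g h : 'rV[R]_n -> R.

Let centers (c : 'I_N -> R) := [seq (c i, xi i) | i <- index_enum 'I_N].

Let centersD c : supported D (centers c).
Proof. by move=> p /mapP[i _ ->]; exact: xiD. Qed.

Let centersE c y : kcomb K (centers c) y = \sum_i c i * K (xi i) y.
Proof. by rewrite /kcomb big_map. Qed.

Lemma center_native h : V h -> H h.
Proof.
move=> [c hE]; apply: (native_kcomb (@centersD c)) => y yD.
by rewrite centersE hE.
Qed.

Lemma native_dot_center f h c : H f ->
  (forall y, D y -> h y = \sum_i c i * K (xi i) y) ->
  dot f h = \sum_i c i * f (xi i).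
Proof.
move=> Hf hE; rewrite (native_dot_kcomb KD Hf (@centersD c)) ?big_map//.
by move=> y yD; rewrite centersE hE.
Qed.

(** The coefficients of the projection solve a linear system whose matrix, the
    Gram matrix G of the centers, may be singular.  It is solvable all the same:
    for d in the kernel of G, the combination h of sections with coefficients d
    vanishes at the centers, so <h, h> = 0 and, by Cauchy-Schwarz,
    sum_i d_i f (xi_i) = <f, h> = 0; thus the right-hand side is orthogonal to
    the kernel of the symmetric matrix G. *)
Lemma center_orth_proj_ex f : H f ->
  exists p, V p /\ forall h, V h -> dot (f \- p) h = 0.
Proof.
move=> Hf; pose G := \matrix_(i, j) K (xi i) (xi j).
pose b := \row_j f (xi j).
have /submxP[c bE] : (b <= G)%MS.
  rewrite submxE; move: (cokermx G) (mulmx_coker G) => C GC0.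
  apply/eqP/rowP => j; rewrite mxE [RHS]mxE; pose d i := C i j.
  pose h y := \sum_i d i * K (xi i) y.
  have Vh : V h by exists d.
  have hxi i : h (xi i) = 0.
    have /matrixP/(_ i j) := GC0; rewrite !mxE => <-.
    by apply: eq_bigr => k _; rewrite !mxE mulrC (mercer_sym KD).
  have hh : dot h h = 0.
    rewrite (@native_dot_center h h d) ?big1//; last exact: center_native.
    by move=> i _; rewrite hxi mulr0.
  have := native_dot_CS KD Hf (center_native Vh).
  rewrite hh mulr0 (@native_dot_center f h d)//.
  move=> fh0; have /eqP := le_anti (introT andP (conj fh0 (sqr_ge0 _))).
  rewrite sqrf_eq0 => /eqP dz; apply: etrans dz.
  by apply: eq_bigr => k _; rewrite !mxE mulrC.
pose p y := \sum_i c 0 i * K (xi i) y.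
have Vp : V p by exists (c 0).
exists p; split => // h [d hE].
rewrite (@native_dot_center _ _ d)//; last first.
  exact: (native_sub KD Hf (center_native Vp)).
rewrite big1// => i _; rewrite /=.
have := bE => /rowP/(_ i); rewrite !mxE => ->.
by rewrite /p; under eq_bigr do rewrite mxE; rewrite subrr mulr0.
Qed.

Lemma orth_projP f : H f -> V (orth_proj D K V f) /\
  forall h, V h -> dot (f \- orth_proj D K V f) h = 0.
Proof. by move=> Hf; exact: getPex (center_orth_proj_ex Hf). Qed.

(** The reproducing kernel of the subspace at x is the projection of K_x. *)
Lemma repr_kernelP x : D x -> V (repr_kernel D K V x) /\
  forall f, V f -> dot f (repr_kernel D K V x) = f x.
Proof.
move=> xD.
apply: (@getPex _ [set k | V k /\ forall f, V f -> dot f k = f x]).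
have HKx := native_section K xD.
have [k [Vk kE]] := center_orth_proj_ex HKx.
exists k; split=> // f Vf; have Hf := center_native Vf.
have := kE _ Vf; rewrite native_dotBl//; last exact: center_native.
rewrite native_dot_sym// native_reproducing//.
rewrite [dot k f]native_dot_sym//; last exact: center_native.
by move/eqP; rewrite subr_eq0 => /eqP.
Qed.

(** With k the reproducing kernel at x, |K_x - k|^2 = K x x - 2 k x + k x. *)
Lemma power_funE x : D x -> power_fun D K V x =
  native_norm D K (K x \- repr_kernel D K V x).
Proof.
move=> xD; have [Vk kE] := repr_kernelP xD; have HKx := native_section K xD.
have Hk := center_native Vk.
rewrite /power_fun /native_norm; congr Num.sqrt.
rewrite native_dotBl//; last exact: native_sub.
rewrite !native_dotBr// (kE _ Vk).
rewrite [dot (K x) (repr_kernel D K V x)]native_dot_sym//.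
by rewrite !native_reproducing// subrr subr0.
Qed.

Lemma power_fun_le x : D x -> power_fun D K V x <= Num.sqrt (K x x).
Proof.
move=> xD; have [Vk kE] := repr_kernelP xD.
apply: ler_wsqrtr; rewrite gerBl -kE//; apply: (native_dot_ge0 KD).
exact: center_native.
Qed.

(** As f is orthogonal to the reproducing kernel k of the subspace at x,
    f x = <f, K_x> = <f, K_x - k>. *)
Lemma residual_le f x : H f -> (forall h, V h -> dot f h = 0) -> D x ->
  `|f x| <= native_norm D K f * power_fun D K V x.
Proof.
move=> Hf fV xD; have [Vk _] := repr_kernelP xD.
have HKx := native_section K xD; have Hk := center_native Vk.
rewrite power_funE//.
rewrite (_ : f x = dot f (K x \- repr_kernel D K V x)).
  by apply: (native_dot_normM KD) => //; exact: native_sub.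
by rewrite native_dotBr// (fV _ Vk) subr0 native_reproducing.
Qed.

End projection.

(** * Borel sets and compact sets of R^n *)

Section rV_borel.
Context {R : realType} {n : nat}.
Implicit Types (D U : set 'rV[R]_n) (f : 'rV[R]_n -> R).

(** An open set is the union of the cubes with rational center and radius
    1/(k+1) that it contains; there are countably many of them. *)
Lemma open_measurable_rV U : open U -> measurable U.
Proof.
move=> oU.
pose box (p : 'rV[rat]_n * nat) := [set x : 'rV[R]_n |
  forall i, `|x 0 i - ratr (p.1 0 i)| < p.2.+1%:R^-1].
have mbox p : measurable (box p).
  rewrite (_ : box p = \bigcap_(i in [set: 'I_n])
      ((fun x : 'rV[R]_n => x 0 i : measurableTypeR R) @^-1`
        [set a | `|a - ratr (p.1 0 i)| < p.2.+1%:R^-1])).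
    apply: fin_bigcap_measurable => // i _.
    rewrite -[X in measurable X]setTI; apply: measurable_rV_coord => //.
    rewrite (_ : [set a | _] = ball (ratr (p.1 0 i) : R) p.2.+1%:R^-1).
      exact: measurable_ball.
    by rewrite -ball_normE; apply/seteqP; split => a /=; rewrite distrC.
  by apply/seteqP; split => x /= xp i => [_|]; exact: xp.
(* replacing the unwanted cubes by set0 makes the union range over a whole
   countable type *)
rewrite (_ : U = \bigcup_p (if `[< box p `<=` U >] then box p else set0)).
  apply: countable_bigcupT_measurable => [|p]; first exact: countableP.
  by case: ifP.
apply/seteqP; split=> [x Ux|x [p _]]; last by case: asboolP => // + px; apply.
have /nbhs_ballP[e /= e0 xe] : nbhs x U by exact: open_nbhs_nbhs.
(* a cube around a center near x must fit in the ball of radius e around x *)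
have [k ke] : exists k : nat, k.+1%:R^-1 < e / 2.
  have e20 : 0 < e / 2 by rewrite divr_gt0.
  have := near_infty_natSinv_lt (PosNum e20) => -[k _ /(_ k (leqnn k))].
  by exists k.
have k0 : 0 < k.+1%:R^-1 :> R by rewrite invr_gt0.
have q i : {q : rat | `|x 0 i - ratr q| < k.+1%:R^-1}.
  apply: cid; have [q] := @rat_in_itvoo R (x 0 i) (x 0 i + k.+1%:R^-1)
    (ltac:(by rewrite ltrDl)).
  rewrite in_itv/= => /andP[xq qx]; exists q.
  by rewrite distrC ger0_norm ?subr_ge0 ?ltW// ltrBlDl.
exists (\row_i sval (q i), k) => //.
case: asboolP => [_|[]]; first by move=> i /=; rewrite mxE; exact: svalP (q i).
move=> y /= yq; apply: xe; split=> // i j; rewrite -ball_normE /= !ord1.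
have := yq j; have := svalP (q j); rewrite mxE => xq yq'.
rewrite (_ : x 0 j - y 0 j = (x 0 j - ratr (sval (q j))) -
  (y 0 j - ratr (sval (q j)))); last by ring.
apply: (le_lt_trans (ler_normB _ _)).
by rewrite (splitr e) ltrD// (lt_trans _ ke).
Qed.

Lemma continuous_measurable_rV D f : measurable D ->
  {within D, continuous f} -> measurable_fun D f.
Proof.
move=> mD /continuousP cf; apply: (measurability _ (RGenOpens.measurableE R)).
move=> _ [_ [a [b ->] <-]].
have /cf/open_subspaceP[V oV VD] : open (`]a, b[%classic : set R).
  exact: interval_open.
by rewrite setIC -VD; apply: measurableI => //; exact: open_measurable_rV.
Qed.

Lemma compact_measurable_rV D : compact D -> measurable D.
Proof.
move=> cD; have clD : closed D by apply: compact_closed cD; exact: norm_hausdorff.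
rewrite -[D]setCK; apply: measurableC; apply: open_measurable_rV.
exact: closed_openC.
Qed.

Lemma compact_lebesgue_rV_lty D : compact D -> (lebesgue_rV D < +oo)%E.
Proof.
move=> cD; have [M0 [_ DM0]] := compact_bounded cD.
pose M := `|M0| + 2.
have DM x : D x -> forall i, - M <= x 0 i <= M.
  move=> Dx i; have xM : `|x| < M.
    apply: (le_lt_trans (DM0 (`|M0| + 1) _ x Dx)); last by rewrite ltrD2l ltr1n.
    by rewrite (le_lt_trans (ler_norm _))// ltrDl.
  have : ball (0 : 'rV[R]_n) M x by rewrite -ball_normE /= sub0r normrN.
  move=> [_ /(_ 0 i)]; rewrite -ball_normE /= mxE sub0r normrN => /ltW.
  by rewrite ler_norml.
have M_ge0 : 0 <= M by rewrite addr_ge0.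
have := @lebesgue_rV_box R n (const_mx (- M)) (const_mx M).
set B := [set x | _] => BE.
apply: (@le_lt_trans _ _ (lebesgue_rV B)); last first.
  by rewrite BE ?ltry// => i; rewrite !mxE ge0_cp.
apply: le_measure.
- by rewrite inE; exact: compact_measurable_rV.
- rewrite inE (_ : B = \bigcap_(i in [set: 'I_n])
      ((fun x : 'rV[R]_n => x 0 i : measurableTypeR R) @^-1` `[- M, M])).
    apply: fin_bigcap_measurable => // i _.
    by rewrite -[X in measurable X]setTI; exact: measurable_rV_coord.
  apply/seteqP; split => x /= xB i.
    by move=> _ /=; rewrite in_itv /=; have := xB i; rewrite !mxE.
  by rewrite !mxE; have := xB i I; rewrite /= in_itv.
- by move=> x Dx i; rewrite !mxE; exact: DM.
Qed.

End rV_borel.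

(** * Square-integrable functions on a set of finite measure *)

Section L2_L1.
Context d (T : measurableType d) (R : realType).
Context (mu : {measure set T -> \bar R}) (D : set T).
Context (mD : measurable D) (Doo : (mu D < +oo)%E).

Lemma indic_Lfun2 : (\1_D : T -> R) \in Lfun mu 2%:E.
Proof.
rewrite inE; apply/andP; split; rewrite inE/=; first exact: measurable_indic.
rewrite /finite_norm unlock poweR_lty//.
rewrite (_ : (\int[mu]_x _)%E = mu D)//.
rewrite -[X in _ = mu X]setIT -integral_indic//; apply: eq_integral => x _ /=.
by rewrite indicE; case: (x \in D); rewrite /= ?normr1 ?normr0 ?powR1 ?powR0.
Qed.

Lemma Lfun2_integrable_set (u : T -> R) : u \_ D \in Lfun mu 2%:E ->
  mu.-integrable D (EFin \o u) /\
  \int[mu]_(x in D) `|u x| <=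
    fine 'N[mu]_2%:E[EFin \o (\1_D : T -> R)] * fine 'N[mu]_2%:E[EFin \o u \_ D].
Proof.
move=> uL; have uE : u \_ D = u \_ D \* \1_D.
  apply/funext => x /=; rewrite indicE patchE.
  by case: ifP; rewrite ?mulr1 ?mul0r.
have iu : mu.-integrable D (EFin \o u).
  apply/(integrable_mkcond _ mD); rewrite restrict_EFin; apply/Lfun1_integrable.
  by rewrite uE; exact: Lfun2_mul_Lfun1 indic_Lfun2.
split => //.
have /andP[] := uL; rewrite !inE/= => mu2 fu.
have /andP[] := indic_Lfun2; rewrite !inE/= => m1 f1.
have hoelder22 : ('N[mu]_1[EFin \o u \_ D] <=
    'N[mu]_2%:E[EFin \o u \_ D] * 'N[mu]_2%:E[EFin \o (\1_D : T -> R)])%E.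
  rewrite {1}uE; apply: hoelder => //.
  by rewrite [RHS]splitr !div1r.
rewrite -lee_fin EFinM /Rintegral !fineK ?ge0_fin_numE ?Lnorm_ge0//; first last.
- exact: integral_ge0.
- by move/integrableP: iu => [].
rewrite muleC; apply: le_trans hoelder22.
rewrite Lnorm1 integral_mkcond.
rewrite (_ : (\int[mu]_x _)%E = (\int[mu]_x `|(EFin \o u \_ D) x|)%E)//.
apply: eq_integral => x _.
by rewrite /= !patchE; case: ifP => // _; rewrite normr0.
Qed.

End L2_L1.

(** * Pairing with the image of the integral operator *)

Section kernel_operator.
Context {R : realType} {n : nat} (D : set 'rV[R]_n) (cD : compact D).
Context (K : 'rV[R]_n -> 'rV[R]_n -> R) (KD : mercer_kernel D K).
Local Notation mu := (@lebesgue_rV R n).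
Local Notation H := (native_space D K).
Local Notation dot := (native_dot D K).
Local Notation norm := (native_norm D K).
Implicit Types (f u v : 'rV[R]_n -> R).

Let mD : measurable D := compact_measurable_rV cD.

Lemma native_norm_section x : D x -> norm (K x) = Num.sqrt (K x x).
Proof.
by move=> xD; rewrite /native_norm native_reproducing//; exact: native_section.
Qed.

Lemma native_le f x : H f -> D x -> `|f x| <= norm f * Num.sqrt (K x x).
Proof.
move=> Hf xD; have HKx := native_section K xD.
rewrite -(native_reproducing KD Hf xD).
by rewrite -(native_norm_section xD) native_dot_normM.
Qed.

Lemma section_integrable u x : D x -> mu.-integrable D (EFin \o u) ->
  mu.-integrable D (EFin \o (K x \* u)).
Proof.
move=> xD iu; apply: (@integrableMr _ _ _ _ _ mD (K x) (EFin \o u)) => //.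
  apply: continuous_measurable_rV => //; apply/subspace_continuousP => y yD.
  have /subspace_continuousP/(_ (x, y)) := mercer_continuous KD.
  move=> /(_ (conj xD yD)) Kxy.
  apply: (@cvg_comp _ _ _ (fun z => (x, z)) (fun p => K p.1 p.2) _ _ _ _ Kxy).
  move=> A; rewrite /= /within/= => -[[A1 A2] /= [A1x A2y] A12].
  apply: filterS A2y => z A2z zD; apply: (A12 (x, z)) => //; split => //=.
  exact: nbhs_singleton A1x.
have [M KM] := mercer_bounded KD.
exists (Num.sqrt (K x x) * Num.sqrt M); split; first exact: num_real.
move=> a Ma y yD /=; apply: le_trans (ltW Ma).
apply: (le_trans (native_le (native_section K xD) yD)).
by rewrite native_norm_section// ler_wpM2l ?sqrtr_ge0// ler_wsqrtr// KM.
Qed.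

Lemma kcomb_integral u (s : seq (R * 'rV[R]_n)) :
  mu.-integrable D (EFin \o u) -> supported D s ->
  mu.-integrable D (EFin \o (kcomb K s \* u)) /\
  \int[mu]_(y in D) (kcomb K s y * u y) =
    \sum_(p <- s) p.1 * kernel_op D K u p.2.
Proof.
move=> iu; elim: s => [|p s IH] sD.
  rewrite (_ : kcomb K [::] \* u = cst 0); last first.
    by apply/funext => y; rewrite /= /kcomb big_nil mul0r.
  split; first exact: integrable0.
  rewrite big_nil; under eq_Rintegral do rewrite /kcomb big_nil mul0r.
  by rewrite Rintegral_cst// mul0r.
have pD : D p.2 by apply: sD; rewrite mem_head.
have [|ints IHs] := IH; first by move=> q qs; apply: sD; rewrite inE qs orbT.
have ip := section_integrable pD iu.
have ip1 : mu.-integrable D (EFin \o (fun y => p.1 * (K p.2 y * u y))).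
  rewrite (_ : _ \o _ = fun y => p.1%:E * (K p.2 y * u y)%:E)%E//.
  exact: integrableZl.
have E : kcomb K (p :: s) \* u = fun y => p.1 * (K p.2 y * u y) + kcomb K s y * u y.
  by apply/funext => y; rewrite /= /kcomb big_cons mulrDl mulrA.
split.
  rewrite E (_ : _ \o _ = (EFin \o (fun y => p.1 * (K p.2 y * u y))%R \+
    (EFin \o (kcomb K s \* u)%R))%E)//.
  exact: integrableD.
rewrite big_cons -IHs /kernel_op -RintegralZl// -RintegralD//.
by apply: eq_Rintegral => y _; have := congr1 (@^~ y) E.
Qed.

(** The integral of f u itself is avoided: f is approximated in norm within e by
    a combination g of sections, for which <g, v> is the integral of g u and
    whose values on D are at most B + e sqrt M, with M a bound of the diagonal of
    K.  This leaves an error proportional to e. *)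
Lemma native_dot_kernel_op_le f v u (B : R) : H f -> H v ->
  mu.-integrable D (EFin \o u) ->
  (forall x, D x -> v x = kernel_op D K u x) ->
  (forall x, D x -> `|f x| <= B) ->
  `|dot f v| <= B * \int[mu]_(x in D) `|u x|.
Proof.
move=> Hf Hv iu vE fB; set I := \int[mu]_(x in D) `|u x|.
have iu' : mu.-integrable D (EFin \o (fun y => `|u y|)) by exact: integrable_norm.
have I0 : 0 <= I by exact: Rintegral_ge0.
have [M KM] := mercer_bounded KD.
have close (e : R) : 0 < e ->
    `|dot f v| <= B * I + e * (norm v + Num.sqrt M * I).
  move=> e0; have [t [tD tf]] := native_dense KD Hf e0.
  have Ht : H (kcomb K t) by exact: native_kcomb tD _.
  have [it tE] := kcomb_integral iu tD.
  have tv : dot (kcomb K t) v = \int[mu]_(y in D) (kcomb K t y * u y).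
    rewrite tE native_dot_sym// (@native_dot_kcomb _ _ _ _ KD _ _ t)//.
    by apply: eq_big_seq => p pt; rewrite vE//; exact: tD.
  have -> : dot f v = dot (f \- kcomb K t) v + dot (kcomb K t) v.
    by rewrite native_dotBl// subrK.
  have tB x : D x -> `|kcomb K t x| <= B + e * Num.sqrt M.
    move=> xD; have -> : kcomb K t x = f x - (f x - kcomb K t x) by ring.
    apply: (le_trans (ler_normB _ _)); apply: lerD; first exact: fB.
    apply: (le_trans (native_le (native_sub KD Hf Ht) xD)).
    by apply: ler_pM => //; rewrite ?sqrtr_ge0// ler_wsqrtr// KM.
  apply: (le_trans (ler_normD _ _)).
  have -> : B * I + e * (norm v + Num.sqrt M * I) =
    e * norm v + (B + e * Num.sqrt M) * I by ring.
  apply: lerD.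
    apply: (le_trans (native_dot_normM KD (native_sub KD Hf Ht) Hv)).
    by rewrite ler_wpM2r// sqrtr_ge0.
  rewrite tv; apply: (le_trans (le_normr_Rintegral mD it)).
  rewrite -RintegralZl//; apply: le_Rintegral => //.
  - exact: integrable_norm.
  - exact: (integrableZl mD _ iu').
  - by move=> x xD; rewrite normrM ler_wpM2r// tB.
set C := norm v + Num.sqrt M * I.
have C0 : 0 <= C by rewrite addr_ge0 ?sqrtr_ge0// mulr_ge0 ?sqrtr_ge0.
apply/ler_addgt0Pr => e e0; have C1 : 0 < C + 1 by rewrite ltr_wpDl.
apply: (le_trans (close (e / (C + 1)) _)); first by rewrite divr_gt0.
rewrite lerD2l -/C mulrAC ler_pdivrMr//.
by apply: ler_wpM2l; [exact: ltW|rewrite lerDl].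
Qed.

End kernel_operator.

(** * The error of the projection *)

Theorem theorem4 (R : realType) (n : nat) (Omega : set 'rV[R]_n)
    (K : 'rV[R]_n -> 'rV[R]_n -> R)
    (Omega_compact : compact Omega) (K_mercer : mercer_kernel Omega K) :
  exists C : R, 0 < C /\
    forall (N : nat) (xi : 'I_N -> 'rV[R]_n),
      injective xi -> (forall i, Omega (xi i)) ->
    forall v u : 'rV[R]_n -> R,
      native_space Omega K v -> L2 Omega u ->
      (forall x, Omega x -> v x = kernel_op Omega K u x) ->
    let H_N := center_space Omega K xi in
    native_norm Omega K (v \- orth_proj Omega K H_N v) <=
      C * sup [set `|power_fun Omega K H_N x| | x in Omega] * L2_norm Omega u.
Proof.
have mO := compact_measurable_rV Omega_compact.
have Ooo := compact_lebesgue_rV_lty Omega_compact.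
set A := fine 'N[@lebesgue_rV R n]_2%:E[EFin \o (\1_Omega : _ -> R)].
have A0 : 0 <= A by rewrite fine_ge0// Lnorm_ge0.
exists (A + 1); split; first by rewrite ltr_wpDl.
move=> N xi _ xiO v u Hv uL vE /=.
have [iu uI] := Lfun2_integrable_set mO Ooo uL; rewrite -/A in uI.
have [Vp pE] := orth_projP K_mercer xiO Hv.
set V := center_space _ _ _ in Vp pE *; set p := orth_proj _ _ _ _ in Vp pE *.
have Hp := center_native xiO Vp; have He := native_sub K_mercer Hv Hp.
set S := sup _; set r := native_norm _ _ _.
have r0 : 0 <= r by exact: sqrtr_ge0.
(* a finite bound is required: sup is 0 by default on unbounded sets *)
have [M KM] := mercer_bounded K_mercer.
have S_ub : has_ubound [set `|power_fun Omega K V x| | x in Omega].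
  exists (Num.sqrt M) => _ [x xO <-]; rewrite ger0_norm ?sqrtr_ge0//.
  apply: (le_trans (power_fun_le K_mercer xiO xO)).
  by rewrite ler_wsqrtr// KM.
have S0 : 0 <= S.
  have [/eqP Omega0|/set0P[x xO]] := boolP (Omega == set0).
    by rewrite /S Omega0 image_set0 sup0.
  apply: (le_trans (normr_ge0 (power_fun Omega K V x))).
  by apply: (ub_le_sup S_ub); exists x.
have eB x : Omega x -> `|(v \- p) x| <= r * S.
  move=> xO; apply: (le_trans (residual_le K_mercer xiO He pE xO)).
  apply: ler_wpM2l => //; apply: (le_trans (ler_norm _)).
  by apply: (ub_le_sup S_ub); exists x.
have rr : r ^+ 2 <= r * S * \int[@lebesgue_rV R n]_(x in Omega) `|u x|.
  rewrite sqr_sqrtr ?native_dot_ge0//.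
  rewrite [X in X <= _](_ : _ = native_dot Omega K (v \- p) v).
    apply: le_trans (ler_norm _) _.
    exact: (native_dot_kernel_op_le Omega_compact K_mercer He Hv iu vE eB).
  by rewrite native_dotBr// (pE _ Vp) subr0.
have u0 : 0 <= L2_norm Omega u by rewrite fine_ge0// Lnorm_ge0.
have [->|rneq0] := eqVneq r 0; first by rewrite !mulr_ge0// addr_ge0.
have rgt0 : 0 < r by rewrite lt_neqAle eq_sym rneq0.
move: rr; rewrite expr2 -mulrA ler_pM2l// => /le_trans; apply.
rewrite [_ * S]mulrC -mulrA; apply: ler_wpM2l => //.
by apply: (le_trans uI); rewrite ler_wpM2r// lerDl.
Qed.
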